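(* Let $K\subset\mathbb{R}^n$ be a centrally symmetric convex body. Let $\varepsilon\in(0,1)$, let $K_1,\ldots,K_m$ be affine copies of $K$ and let $K'_j$ be the result of scaling $K_j$ by a factor of $2$ around its center point. Suppose that $K'_j\subseteq H=[-1,1]^n$ for all $j$, and that $K_1\cup\cdots\cup K_m\supseteq H_\varepsilon=[-1+\varepsilon,1-\varepsilon]^n$. Then $m\ge c_n\left(1+\lfloor\log 1/\varepsilon\rfloor\right)^n$, where $c_n>0$ is a constant depending only on $n$.
   Context: An affine copy of $K$ is the image of $K$ under an invertible affine map; its center point is the image of the center of symmetry of $K$. Logarithms are base 2. *)

(* Defs.v *)
From HB Require Import structures.
From mathcomp Require Import all_boot all_order all_algebra.
From mathcomp Require Import all_classical all_reals all_analysis.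

Set Implicit Arguments.
Unset Strict Implicit.
Unset Printing Implicit Defensive.

Import Order.TTheory GRing.Theory Num.Theory.
Import numFieldNormedType.Exports.

Local Open Scope classical_set_scope.
Local Open Scope ring_scope.

Definition convex_body (R : realType) (n : nat) (K : set 'rV[R]_n) : Prop :=
  [/\ compact K, convex_set K & K° !=set0].

(* The point p is then unique when K is nonempty and bounded. *)
Definition center_of_symmetry (R : realType) (n : nat) (K : set 'rV[R]_n)
    (p : 'rV[R]_n) : Prop :=
  [set p *+ 2 - x | x in K] = K.

Definition invertible_affine_map (R : realType) (n : nat)
    (f : 'rV[R]_n -> 'rV[R]_n) : Prop :=
  exists2 A : 'M[R]_n, A \in unitmx &
    exists b : 'rV[R]_n, forall x, f x = x *m A + b.

Definition scale_around (R : realType) (n : nat) (q : 'rV[R]_n) (t : R)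
    (S : set 'rV[R]_n) : set 'rV[R]_n :=
  [set q + t *: (x - q) | x in S].

Definition cube (R : realType) (n : nat) (a b : R) : set 'rV[R]_n :=
  [set x : 'rV[R]_n | forall i, a <= x ord0 i <= b].

Arguments cube {R} n a b _.

Definition log2 (R : realType) (x : R) : R := ln x / ln 2.

(* Main.v *)
Require Import Defs.
From HB Require Import structures.
From mathcomp Require Import all_boot all_order all_algebra.
From mathcomp Require Import all_classical all_reals all_analysis.
From mathcomp Require Import zify lra.

Set Implicit Arguments.
Unset Strict Implicit.
Unset Printing Implicit Defensive.

Import Order.TTheory GRing.Theory Num.Theory.
Import numFieldNormedType.Exports.

Local Open Scope classical_set_scope.
Local Open Scope ring_scope.

(* If [K] has center [q] and its double lies in [H = [-1,1]^n], then the
   distances to the facet [x_i = 1] of any two points of [K] differ by a factor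
   at most 3: reflecting [x] in [q] and doubling bounds [1 - x_i] by
   [3/2 (1 - q_i)], while doubling [y] bounds [1 - q_i] by [2 (1 - y_i)].
   Hence [K] contains at most one point whose coordinates all have the form
   [1 - 4^-k], and about [(log(1/eps) / 2)^n] such points lie in [H_eps]. *)

(** The weights 2 and -1 in [p *+ 2 - x] sum to 1, so an affine map preserves this combination. *)
Lemma center_of_symmetry_affine (R : realType) (n : nat) (K : set 'rV[R]_n)
    (p : 'rV[R]_n) (f : 'rV[R]_n -> 'rV[R]_n) :
  invertible_affine_map f -> center_of_symmetry K p ->
  center_of_symmetry (f @` K) (f p).
Proof.
move=> [A _ [b fE]] Kp.
have fK x : f (p *+ 2 - x) = f p *+ 2 - f x.
  by apply/rowP => i; rewrite !fE !mulr2n mulmxBl mulmxDl !mxE; lra.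
rewrite /center_of_symmetry -[in RHS]Kp; apply/seteqP; split => y /=.
  by move=> [_ [x Kx <-] <-]; exists (p *+ 2 - x); [exists x | rewrite fK].
by move=> [_ [x Kx <-] <-]; exists (f x); [exists x | rewrite fK].
Qed.

Lemma facet_distance_ratio (R : realType) (n : nat) (S : set 'rV[R]_n)
    (q x y : 'rV[R]_n) (i : 'I_n) :
  center_of_symmetry S q -> scale_around q 2 S `<=` cube n (- 1) 1 ->
  S x -> S y -> 1 - x ord0 i <= 3 * (1 - y ord0 i).
Proof.
move=> Sq SH Sx Sy.
have Sx' : S (q *+ 2 - x) by rewrite -Sq; exists x.
(* The doubled points are [3q - 2x] and [2y - q]; the first bound plus three times the second
   eliminates [q]. *)
have /andP[_] := SH _ (ex_intro2 _ _ _ Sx' erefl) i.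
have /andP[_] := SH _ (ex_intro2 _ _ _ Sy erefl) i.
rewrite mulr2n !mxE; lra.
Qed.

(** Distinct powers of 1/4 differ by a factor of at least 4, which exceeds the ratio 3 allowed
    inside one copy. *)
Lemma expr4_ratio_inj (R : realType) (k l : nat) :
  4^-1 ^+ k <= 3 * 4^-1 ^+ l :> R -> 4^-1 ^+ l <= 3 * 4^-1 ^+ k :> R -> k = l.
Proof.
wlog lekl : k l / (k <= l)%N.
  by move=> W h1 h2; case/orP: (leq_total k l) => le; [|symmetry]; apply: W.
move=> h _; apply/eqP; rewrite eqn_leq lekl /= leqNgt; apply/negP => ltkl.
have k0 : 0 < 4^-1 ^+ k :> R by apply: exprn_gt0; lra.
have : 4^-1 ^+ l <= 4^-1 ^+ k.+1 :> R.
  by apply: ler_wiXn2l => //; lra.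
by rewrite exprS; lra.
Qed.

(** As [1 / eps > 1], the logarithm is nonnegative, so its floor can serve as a natural exponent;
    exponentiating [F * ln 2 <= ln (1 / eps)] gives the bound. *)
Lemma floor_log2_inv (R : realType) (eps : R) : 0 < eps < 1 ->
  exists2 F : nat, Num.floor (log2 (1 / eps)) = F & eps <= 2^-1 ^+ F.
Proof.
move=> /andP[e0 e1].
have l20 : 0 < ln 2 :> R by apply: ln_gt0; lra.
have lg0 : 0 <= log2 (1 / eps).
  by apply: divr_ge0; [apply: ln_ge0; rewrite div1r invf_ge1 // ltW | apply: ltW].
have : 0 <= Num.floor (log2 (1 / eps)) by rewrite floor_ge0.
case E : (Num.floor _) => [F|//] _; exists F => //.
have := floor_le (log2 (1 / eps)); rewrite E -pmulrn /log2 ler_pdivlMr //.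
rewrite mulr_natl -lnXn // div1r ler_ln ?posrE ?exprn_gt0 ?invr_gt0 //.
by move=> h; rewrite exprVn -[eps]invrK lef_pV2 ?posrE ?exprn_gt0 ?invr_gt0.
Qed.

Theorem theorem2p7 (R : realType) (n : nat) :
  exists2 c : R, 0 < c &
    forall (K : set 'rV[R]_n) (p : 'rV[R]_n) (eps : R) (m : nat)
      (f : 'I_m -> 'rV[R]_n -> 'rV[R]_n),
      convex_body K ->
      center_of_symmetry K p ->
      0 < eps < 1 ->
      (forall j, invertible_affine_map (f j)) ->
      (forall j, scale_around (f j p) 2 (f j @` K) `<=` cube n (- 1) 1) ->
      cube n (- 1 + eps) (1 - eps) `<=` \bigcup_(j in [set: 'I_m]) (f j @` K) ->
      c * ((1 + Num.floor (log2 (1 / eps)))%:~R ^+ n) <= m%:R.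
Proof.
(* Powers of 4 use only every second power of 2, which costs a factor 2 per coordinate. *)
exists (2^-1 ^+ n) => [|K p eps m f _ Kp eps01 fA fH cov].
  by apply: exprn_gt0; lra.
have [F -> epsF] := floor_log2_inv eps01.
(* [N] counts the exponents [k >= 0] with [2k <= F], those for which [4^-k >= 2^-F >= eps]. *)
pose N := F./2.+1.
pose pt (g : {ffun 'I_n -> 'I_N}) : 'rV[R]_n := \row_i (1 - 4^-1 ^+ g i).
have pt_cov g : exists j, (f j @` K) (pt g).
  have [i|j _ ?] := cov (pt g); last by exists j.
  have : eps <= 4^-1 ^+ g i.
    have -> : 4^-1 = 2^-1 ^+ 2 :> R by rewrite expr2; lra.
    rewrite -exprM; apply: le_trans epsF _; apply: ler_wiXn2l; [lra|lra|].
    by have := ltn_ord (g i); rewrite /N; lia.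
  (* This handles the lower faces of the small cube: the coordinates of [pt g] are nonnegative. *)
  have : 4^-1 ^+ g i <= 1 :> R by apply: exprn_ile1; lra.
  by rewrite mxE; lra.
(* [J] picks a copy covering each of the [N ^ n] points; its injectivity will bound [m] from
   below. *)
pose J g := projT1 (cid (pt_cov g)).
have ptJ g : (f (J g) @` K) (pt g) by rewrite /J; case: cid.
have J_inj : injective J.
  move=> g h Jgh; apply/ffunP => i; apply/val_inj => /=.
  have sym := center_of_symmetry_affine (fA (J h)) Kp.
  have ptg := ptJ g; rewrite Jgh in ptg.
  have := facet_distance_ratio i sym (fH _) ptg (ptJ h).
  have := facet_distance_ratio i sym (fH _) (ptJ h) ptg.
  by rewrite !mxE !subKr => *; apply: (@expr4_ratio_inj R).
have : (N ^ n <= m)%N.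
  by have := leq_card J J_inj; rewrite card_ffun !card_ord.
rewrite -(ler_nat R); apply: le_trans.
have -> : (1 + F%:Z)%:~R = F.+1%:R :> R by rewrite -PoszD pmulrn.
have F0 : 0 <= F.+1%:R :> R by apply: ler0n.
have : (F.+1 <= 2 * N)%N by rewrite /N; lia.
rewrite -(ler_nat R) natrM => FN.
by rewrite natrX -exprMn; apply: lerXn2r; rewrite ?nnegrE; lra.
Qed.
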